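(* The generalized Camassa-Holm equation $$u_t - u_{xxt} = u^2 u_{xxx} - u^2u_{xx}-3uu_x^2-2u^2u_x+4u u_x u_{xx}+u_x^3,$$ for a real-valued function $u=u(x,t)$, describes pseudospherical surfaces. Moreover, it is geometrically integrable.
   Context: A differential equation for a real-valued function $u(x,t)$ describes pseudospherical surfaces if it corresponds to the structure equations of a surface with Gaussian curvature $K=-1$, that is, if there are 1-forms $\omega_i=f_{i1}\,dx+f_{i2}\,dt$, $1\le i\le 3$, with $\omega_1\wedge\omega_2\neq 0$, whose coefficients $f_{ij}$ are functions of $u$ and its derivatives with respect to $x$ and $t$, such that the equation is equivalent to $$d\omega_1=\omega_3\wedge\omega_2,\qquad d\omega_2=\omega_1\wedge\omega_3,\qquad d\omega_3=\omega_1\wedge\omega_2 .$$ Here $\omega_1\wedge\omega_2\ne0$ is understood for generic solutions: a solution $u:U\subseteq\mathbb{R}^2\to\mathbb{R}$ is generic (with respect to the given 1-forms) if $\omega_1\wedge\omega_2$ is non-zero on $U$ except possibly on a set of measure zero. An equation is geometrically integrable if it describes a non-trivial one-parameter family of pseudospherical surfaces, i.e. the associated 1-forms $\omega_1,\omega_2,\omega_3$ depend non-trivially on a free real parameter while the equation itself does not. *)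

(* Defs.v *)
From HB Require Import structures.
From mathcomp Require Import all_boot all_order all_algebra.
From mathcomp Require Import all_classical all_reals all_analysis.

Set Implicit Arguments.
Unset Strict Implicit.
Unset Printing Implicit Defensive.

Import Order.TTheory GRing.Theory Num.Theory.
Import numFieldNormedType.Exports.

Local Open Scope classical_set_scope.
Local Open Scope ring_scope.

Section Smoothness.
Context {R : realType} {V W : normedModType R}.

Definition iter_derive (f : V -> W) (vs : seq V) : V -> W :=
  foldr (fun v g x => 'D_v g x) f vs.

(* For V finite-dimensional and U open this is the usual class C^k on U: all
   iterated directional derivatives up to order k exist and are continuous. *)
Definition Ck (k : nat) (U : set V) (f : V -> W) : Prop :=
  forall (vs : seq V) (x : V), U x ->
    ((size vs <= k)%N -> {for x, continuous (iter_derive f vs)}) /\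
    ((size vs < k)%N -> forall v : V, derivable (iter_derive f vs) x v).

Definition smooth (f : V -> W) : Prop := forall k : nat, Ck k setT f.

End Smoothness.

Section Plane.
Context {R : realType}.
Implicit Types (u : R * R -> R) (p : R * R).

(* Points of the plane are pairs (x, t). *)
Definition pdx u : R * R -> R := fun p => 'D_((1, 0) : R * R) u p.
Definition pdt u : R * R -> R := fun p => 'D_((0, 1) : R * R) u p.

(* [pd i j u] is u differentiated i times in x, then j times in t. *)
Definition pd (i j : nat) u : R * R -> R := iter j pdt (iter i pdx u).

(* A function of u and its derivatives up to order N is a function on
   [jet_space N]: the entry (i, j) of a jet stands for [pd i j u]; the entries
   with i + j > N are unused and set to 0 in the jet of a function. *)
Definition jet_space (N : nat) : normedModType R := 'M[R]_N.+1.

Definition jet (N : nat) u p : jet_space N :=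
  \matrix_(i, j) if (i + j <= N)%N then pd i j u p else 0.

(* The 1-form [cdx dx + cdt dt]. *)
Record form1 := Form1 { cdx : R * R -> R; cdt : R * R -> R }.

(* 2-forms are identified with their coefficient on dx /\ dt. *)
Definition wedge (a b : form1) : R * R -> R :=
  fun p => cdx a p * cdt b p - cdt a p * cdx b p.

Definition ext_d (a : form1) : R * R -> R :=
  fun p => pdx (cdt a) p - pdt (cdx a) p.

Definition null_set (A : set (R * R)) : Prop :=
  ((@lebesgue_measure R) \x (@lebesgue_measure R))%E.-negligible A.

End Plane.

Section Pseudospherical.
Context {R : realType}.
Implicit Types (u : R * R -> R) (p : R * R) (U : set (R * R)).

(* [E u p] : the equation holds for the function u at the point p. *)
Implicit Types (E : (R * R -> R) -> R * R -> Prop).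

Definition solution E U u : Prop := forall p, U p -> E u p.

(* [f i k] is f_{i+1,k+1}: the coefficient of dx (k = 0) or dt (k = 1) in
   omega_{i+1}. *)
Definition coeffs (N : nat) : Type := 'I_3 -> 'I_2 -> @jet_space R N -> R.

Definition form_of (N : nat) (f : coeffs N) (i : 'I_3) u : form1 :=
  Form1 (fun p => f i 0 (jet N u p)) (fun p => f i 1 (jet N u p)).

Definition omega1 N (f : coeffs N) := form_of f (@Ordinal 3 0 isT).
Definition omega2 N (f : coeffs N) := form_of f (@Ordinal 3 1 isT).
Definition omega3 N (f : coeffs N) := form_of f (@Ordinal 3 2 isT).

Definition structure_equations N (f : coeffs N) u p : Prop :=
  let w1 := omega1 f u in let w2 := omega2 f u in let w3 := omega3 f u in
  [/\ ext_d w1 p = wedge w3 w2 p,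
      ext_d w2 p = wedge w1 w3 p &
      ext_d w3 p = wedge w1 w2 p].

Definition generic N (f : coeffs N) U u : Prop :=
  null_set [set p | U p /\ wedge (omega1 f u) (omega2 f u) p = 0].

(* The equation E, of order r, is equivalent to the structure equations of the
   forms with coefficients f, on functions regular enough for both to make
   sense classically; the requirement omega1 /\ omega2 <> 0 is that generic
   solutions exist (particular solutions, e.g. u = 0, may fail to be generic). *)
Definition pss_forms (r : nat) E N (f : coeffs N) : Prop :=
  (forall U u, open U -> Ck (maxn r N.+1) U u ->
     (solution E U u <-> forall p, U p -> structure_equations f u p)) /\
  (exists U u, [/\ open U, U !=set0, Ck (maxn r N.+1) U u,
                   solution E U u & generic f U u]).

Definition describes_pss (r : nat) E : Prop :=
  exists (N : nat) (f : coeffs N),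
    (forall i k, smooth (f i k)) /\ pss_forms r E f.

(* The sl(2,R)-valued 1-form
     Omega = 1/2 [ omega2 , omega1 - omega3 ; omega1 + omega3 , - omega2 ],
   for which the structure equations read d Omega = Omega /\ Omega. *)
Definition sl2_mx (a b c : R) : 'M[R]_2 :=
  2^-1 *: \matrix_(i, j)
    if i == 0 then (if j == 0 then b else a - c)
              else (if j == 0 then a + c else - b).

Definition Omega_dx N (f : coeffs N) u p : 'M[R]_2 :=
  sl2_mx (cdx (omega1 f u) p) (cdx (omega2 f u) p) (cdx (omega3 f u) p).
Definition Omega_dt N (f : coeffs N) u p : 'M[R]_2 :=
  sl2_mx (cdt (omega1 f u) p) (cdt (omega2 f u) p) (cdt (omega3 f u) p).

(* On solutions, Omega_g = S Omega_f S^-1 + dS S^-1 for some SL(2,R)-valued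
   function S of u and its derivatives. *)
Definition gauge_equivalent (r : nat) E N (f g : coeffs N) : Prop :=
  exists (M : nat) (S : @jet_space R M -> 'M[R]_2),
    [/\ smooth S, forall J, \det (S J) = 1 &
      forall U u, open U -> Ck (maxn r (maxn N M).+1) U u -> solution E U u ->
        forall p, U p ->
        let Su := fun q => S (jet M u q) in
        Omega_dx g u p *m Su p = Su p *m Omega_dx f u p
                                 + 'D_((1, 0) : R * R) Su p /\
        Omega_dt g u p *m Su p = Su p *m Omega_dt f u p
                                 + 'D_((0, 1) : R * R) Su p].

(* The dependence on the parameter eta is non-trivial in the sense that it
   cannot be removed by a gauge transformation. Asking only that some
   coefficient vary with eta would be void: rotating (omega1, omega2) by the
   constant angle eta preserves the structure equations. *)
Definition geometrically_integrable (r : nat) E : Prop :=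
  exists (N : nat) (f : R -> coeffs N),
    [/\ forall i k, smooth (fun z : (R * @jet_space R N)%type => f z.1 i k z.2),
        forall eta : R, pss_forms r E (f eta) &
        forall eta eta' : R, eta <> eta' ->
          ~ gauge_equivalent r E (f eta) (f eta')].

(* u_t - u_xxt = u^2 u_xxx - u^2 u_xx - 3 u u_x^2 - 2 u^2 u_x
                 + 4 u u_x u_xx + u_x^3 *)
Definition generalized_CH u p : Prop :=
  pd 0 1 u p - pd 2 1 u p =
    u p ^+ 2 * pd 3 0 u p - u p ^+ 2 * pd 2 0 u p
    - 3 * u p * pd 1 0 u p ^+ 2 - 2 * u p ^+ 2 * pd 1 0 u p
    + 4 * u p * pd 1 0 u p * pd 2 0 u p + pd 1 0 u p ^+ 3.

End Pseudospherical.

(* Main.v *)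
(** Write Q = u^2 u_xx + u u_x^2 - 2 u^2 u_x and D = d/dx. The equation reads
    (1 - D^2) u_t = (1 + D) Q, so that m = u - u_xx = (1 + D) (u - u_x)
    satisfies m_t = (1 + D) Q. Adding an arbitrary multiple of u - u_x to the
    flux gives, for
      omega1 = omega3 = m dx + (Q + eta (u - u_x)) dt,   omega2 = dx + eta dt,
    a single nontrivial structure equation, which is the given equation for
    every eta. The stationary solution exp (- x / 3) is generic on an open set,
    and on the solution u = 1 one has Omega_dt = eta Omega_dx with
    Omega_dx <> 0, a relation that gauge transformations preserve there. *)
Require Import Defs.
From HB Require Import structures.
From mathcomp Require Import all_boot all_order all_algebra.
From mathcomp Require Import all_classical all_reals all_analysis.
From mathcomp Require Import ring lra.

Set Implicit Arguments.
Unset Strict Implicit.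
Unset Printing Implicit Defensive.
Import Order.TTheory GRing.Theory Num.Theory.
Import numFieldNormedType.Exports.

(** * Elementary functions and their smoothness *)

Section Elementary.
Local Open Scope classical_set_scope.
Local Open Scope ring_scope.
Context {R : realType}.

(* A class of functions visibly closed under directional derivatives, hence
   consisting of smooth functions. *)
Inductive elementary {V : normedModType R} : (V -> R) -> Prop :=
| Elem_cst (c : R) : elementary (fun=> c)
| Elem_lin (L : {linear V -> R}) : continuous L -> elementary L
| Elem_add (f g : V -> R) : elementary f -> elementary g ->
    elementary (fun x => f x + g x)
| Elem_mul (f g : V -> R) : elementary f -> elementary g ->
    elementary (fun x => f x * g x)
| Elem_exp (f : V -> R) : elementary f -> elementary (fun x => expR (f x)).

Context {V : normedModType R}.
Implicit Types f g : V -> R.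

Lemma differentiable_expR (y : R) : differentiable (@expR R) y.
Proof. exact/derivable1_diffP/derivable_expR. Qed.

Lemma elementary_differentiable f : elementary f ->
  forall x, differentiable f x.
Proof.
elim=> [c|L cL|g h _ dg _ dh|g h _ dg _ dh|g _ dg] x.
- exact: differentiable_cst.
- exact: linear_differentiable.
- exact: differentiableD.
- exact: differentiableM.
- apply: differentiable_comp; [exact: dg | exact: differentiable_expR].
Qed.

Lemma derive_linear (L : {linear V -> R}) (v x : V) :
  continuous L -> 'D_v L x = L v.
Proof.
by move=> cL; rewrite deriveE ?diff_lin//; exact: linear_differentiable.
Qed.

Lemma derive_expR_comp f (v x : V) : differentiable f x ->
  'D_v (fun y => expR (f y)) x = expR (f x) * 'D_v f x.
Proof.
move=> df; have de := differentiable_expR (f x).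
rewrite (deriveE v df) deriveE; last exact: differentiable_comp.
rewrite (diff_comp df de)/= deriv1E; last exact: derivable_expR.
by rewrite derive1E derive_val mulrC.
Qed.

Lemma elementary_derive f (v : V) : elementary f ->
  elementary ('D_v f).
Proof.
elim=> [c|L cL|g h eg dg eh dh|g h eg dg eh dh|g eg dg].
- rewrite (_ : 'D_v _ = fun=> 0); first exact: Elem_cst.
  by apply/funext => x; exact: derive_cst.
- rewrite (_ : 'D_v _ = fun=> L v); first exact: Elem_cst.
  by apply/funext => x; rewrite derive_linear.
- rewrite (_ : 'D_v _ = fun x => 'D_v g x + 'D_v h x).
    exact: Elem_add.
  by apply/funext => x; apply: deriveD;
    exact/diff_derivable/elementary_differentiable.
- rewrite (_ : 'D_v _ = fun x => g x * 'D_v h x + h x * 'D_v g x).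
    by apply: Elem_add; exact: Elem_mul.
  by apply/funext => x; apply: deriveM;
    exact/diff_derivable/elementary_differentiable.
- rewrite (_ : 'D_v _ = fun x => expR (g x) * 'D_v g x).
    by apply: Elem_mul => //; exact: Elem_exp.
  apply/funext => x; rewrite derive_expR_comp//.
  exact: elementary_differentiable.
Qed.

(** By [elementary_derive] every iterated directional derivative is elementary again, hence
    differentiable, which gives both continuity and derivability at each order. *)
Lemma elementary_Ck f (k : nat) (U : set V) : elementary f -> Ck k U f.
Proof.
move=> ef vs x _.
have evs : elementary (iter_derive f vs).
  by elim: vs => [//|v vs /= IH]; exact: elementary_derive.
split=> _; first exact/differentiable_continuous/elementary_differentiable.
by move=> v; exact/diff_derivable/elementary_differentiable.
Qed.

Lemma elementary_smooth f : elementary f -> smooth f.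
Proof. by move=> ef k; exact: elementary_Ck. Qed.

Lemma elementary_opp f : elementary f -> elementary (fun x => - f x).
Proof.
move=> ef; rewrite (_ : (fun x => _) = fun x => -1 * f x).
  by apply: Elem_mul => //; exact: Elem_cst.
by apply/funext => x; rewrite mulN1r.
Qed.

Lemma elementary_exprn f n : elementary f -> elementary (fun x => f x ^+ n).
Proof.
move=> ef; elim: n => [|n IH]; first exact: Elem_cst.
rewrite (_ : (fun x => _) = fun x => f x * f x ^+ n); first exact: Elem_mul.
by apply/funext => x; rewrite exprS.
Qed.

End Elementary.

(** * Jet coordinates and the parameter as elementary functions *)

Section Coordinates.
Local Open Scope classical_set_scope.
Local Open Scope ring_scope.
Context {R : realType}.

Lemma elementary_linear (V : normedModType R) (L : V -> R) :
  linear L -> continuous L -> elementary L.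
Proof.
move=> lL cL; pose lM := GRing.isLinear.Build _ _ _ _ _ lL.
pose L' : {linear V -> R} := HB.pack L lM.
exact: (@Elem_lin _ _ L').
Qed.

Lemma elementary_coord m n (i : 'I_m.+1) (j : 'I_n.+1) :
  elementary (fun J : 'M[R]_(m.+1, n.+1) => J i j).
Proof.
apply: elementary_linear; first by move=> a M P; rewrite !mxE.
exact: coord_continuous.
Qed.

Lemma elementary_fst (V : normedModType R) :
  elementary (fun z : (R * V)%type => z.1).
Proof. by apply: elementary_linear => // z; exact: cvg_fst. Qed.

Lemma elementary_snd_coord m n (i : 'I_m.+1) (j : 'I_n.+1) :
  elementary (fun z : (R * 'M[R]_(m.+1, n.+1))%type => z.2 i j).
Proof.
apply: elementary_linear; first by move=> a M P; rewrite /= !mxE.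
move=> z; apply: (@continuous_comp _ _ _ snd (fun J : 'M[R]_(_, _) => J i j)).
  exact: cvg_snd.
exact: coord_continuous.
Qed.

End Coordinates.

(** * The one-parameter family of 1-forms and its structure equations *)

Section Forms.
Local Open Scope classical_set_scope.
Local Open Scope ring_scope.
Context {R : realType}.
Implicit Types (u : R * R -> R) (p : R * R) (eta : R).

(** The flux Q, as a polynomial in u, u_x and u_xx. *)
Definition gch_flux (u ux uxx : R) : R :=
  u ^+ 2 * uxx + u * ux ^+ 2 - 2 * u ^+ 2 * ux.

(** Index 1 is omega2; the last branch serves omega1 and omega3 alike. With N = 2 the regularity
    [maxn 3 N.+1] is exactly the order 3 of the equation. *)
Definition gch_coeffs (eta : R) : @coeffs R 2 := fun i k J =>
  let u := J ord0 ord0 in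
  let ux := J (@Ordinal 3 1 isT) ord0 in
  let uxx := J (@Ordinal 3 2 isT) ord0 in
  if i == @Ordinal 3 1 isT then (if k == 0 then 1 else eta)
  else if k == 0 then u - uxx else gch_flux u ux uxx + eta * (u - ux).

Ltac elem := repeat first [exact: Elem_cst | exact: elementary_coord
  | exact: elementary_fst | exact: elementary_snd_coord
  | apply: elementary_exprn | apply: elementary_opp
  | apply: Elem_add | apply: Elem_mul].

Lemma gch_coeffs_smooth eta i k : smooth (gch_coeffs eta i k).
Proof.
apply: elementary_smooth; rewrite /gch_coeffs /gch_flux.
by case: eqP => _; case: eqP => _; elem.
Qed.

Lemma gch_coeffs_family_smooth i k :
  smooth (fun z : (R * @jet_space R 2)%type => gch_coeffs z.1 i k z.2).
Proof.
apply: elementary_smooth; rewrite /gch_coeffs /gch_flux.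
by case: eqP => _; case: eqP => _; elem.
Qed.

Lemma cdx_omega1 eta u :
  cdx (omega1 (gch_coeffs eta) u) = fun p => u p - pd 2 0 u p.
Proof. by apply/funext => p /=; rewrite /gch_coeffs /= !mxE. Qed.

Lemma cdt_omega1 eta u : cdt (omega1 (gch_coeffs eta) u) =
  fun p => gch_flux (u p) (pd 1 0 u p) (pd 2 0 u p) + eta * (u p - pd 1 0 u p).
Proof. by apply/funext => p /=; rewrite /gch_coeffs /= !mxE. Qed.

Lemma cdx_omega2 eta u : cdx (omega2 (gch_coeffs eta) u) = fun=> 1.
Proof. by []. Qed.

Lemma cdt_omega2 eta u : cdt (omega2 (gch_coeffs eta) u) = fun=> eta.
Proof. by []. Qed.

Lemma omega3E eta u : omega3 (gch_coeffs eta) u = omega1 (gch_coeffs eta) u.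
Proof. by []. Qed.

Lemma is_derive_gch_flux (V : normedModType R) (f g h : V -> R) (x v : V) :
  derivable f x v -> derivable g x v -> derivable h x v ->
  is_derive x v (fun y => gch_flux (f y) (g y) (h y))
    (2 * f x * h x * 'D_v f x + f x ^+ 2 * 'D_v h x
     + g x ^+ 2 * 'D_v f x + 2 * f x * g x * 'D_v g x
     - 4 * f x * g x * 'D_v f x - 2 * f x ^+ 2 * 'D_v g x).
Proof.
move=> /derivableP df /derivableP dg /derivableP dh.
(* Written with the ring operations on functions, the flux gets its derivative from the [is_derive]
   instances. *)
have -> : (fun y => gch_flux (f y) (g y) (h y)) =
    f ^+ 2 * h + f * g ^+ 2 - cst 2 * f ^+ 2 * g.
  by apply/funext => y.
apply: is_derive_eq; rewrite /= ?fctE.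
by rewrite /GRing.scale/=; ring.
Qed.

(** As omega3 = omega1, the first and third equations coincide and the second reads 0 = 0. The
    parameter cancels because eta (u_x - u_xx) + eta (u - u_x) = eta m. *)
Lemma structure_equations_gch eta U u p : Ck 3 U u -> U p ->
  structure_equations (gch_coeffs eta) u p <-> generalized_CH u p.
Proof.
move=> Cu Up.
have d v : [/\ derivable u p v, derivable (pdx u) p v
    & derivable (pd 2 0 u) p v].
  have D vs : (size vs < 3)%N -> derivable (iter_derive u vs) p v.
    by move=> s3; apply: (Cu vs p Up).2.
  split; first exact: (D [::]).
    exact: (D [:: (1, 0)]).
  exact: (D [:: (1, 0); (1, 0)]).
have [du dux duxx] := d (1, 0).
have [dut _ duxxt] := d (0, 1).
have Edt : pdt (cdx (omega1 (gch_coeffs eta) u)) p = pd 0 1 u p - pd 2 1 u p.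
  by rewrite cdx_omega1; exact: deriveB.
have Edx : pdx (cdt (omega1 (gch_coeffs eta) u)) p =
  (2 * u p * pd 2 0 u p * pd 1 0 u p + u p ^+ 2 * pd 3 0 u p
     + pd 1 0 u p ^+ 2 * pd 1 0 u p + 2 * u p * pd 1 0 u p * pd 2 0 u p
     - 4 * u p * pd 1 0 u p * pd 1 0 u p - 2 * u p ^+ 2 * pd 2 0 u p)
   + eta * (pd 1 0 u p - pd 2 0 u p).
  rewrite cdt_omega1.
  have h1 := is_derive_gch_flux du dux duxx.
  have h2 : is_derive p (1, 0) (u - pdx u) (pd 1 0 u p - pd 2 0 u p).
    by apply: is_deriveB; exact: derivableP.
  have h3 := is_deriveD h1 (is_deriveZ eta h2).
  exact: (@derive_val _ _ _ _ _ _ _ h3).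
have E2x : pdx (cdt (omega2 (gch_coeffs eta) u)) p = 0 by exact: derive_cst.
have E2t : pdt (cdx (omega2 (gch_coeffs eta) u)) p = 0 by exact: derive_cst.
rewrite /structure_equations /= omega3E /ext_d Edt Edx E2x E2t /wedge.
rewrite cdx_omega1 cdt_omega1 cdx_omega2 cdt_omega2 /generalized_CH /gch_flux.
move: (u p) (pd 1 0 u p) (pd 2 0 u p) (pd 3 0 u p) (pd 0 1 u p) (pd 2 1 u p).
move=> u0 u1 u2 u3 ut uxxt.
(* With all terms on one side, the structure equation is (1 + D) Q - m_t = 0, the opposite of the
   given equation; hence the [oppr_eq0]. *)
split=> [[E _ _]|E]; [move: E | split; [move: E | by ring | move: E]];
  move=> /eqP; rewrite -subr_eq0 => /eqP E;
  apply/eqP; rewrite -subr_eq0 -oppr_eq0 -[X in _ == X]E; apply/eqP; ring.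
Qed.

End Forms.

(** * The exponential solution and its genericity *)

Section Solutions.
Local Open Scope classical_set_scope.
Local Open Scope ring_scope.
Context {R : realType}.
Implicit Types (u : R * R -> R) (p : R * R) (eta : R).

Definition exp_wave (a : R) p : R := expR (a * p.1).

Lemma elementary_exp_wave a : elementary (exp_wave a).
Proof.
by apply: Elem_exp; apply: Elem_mul; [exact: Elem_cst|exact: elementary_fst].
Qed.

Lemma derive_fst p (v : R * R) : 'D_v (fun q : R * R => q.1) p = v.1.
Proof. by apply: (derive_linear (L := fst)) => q; exact: cvg_fst. Qed.

(** The factor c carries the power of a in the induction on the order of differentiation. *)
Lemma derive_exp_wave a c v p :
  'D_v (fun q => c * exp_wave a q) p = c * (a * v.1) * exp_wave a p.
Proof.
have dfst : differentiable (fun q : R * R => q.1) p.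
  by apply: elementary_differentiable; exact: elementary_fst.
have de := elementary_differentiable (elementary_exp_wave a) p.
have -> : (fun p => c * exp_wave a p) = c \*: exp_wave a by [].
rewrite deriveZ; last exact: diff_derivable.
rewrite derive_expR_comp; last exact: differentiableZ.
have -> : (fun q : R * R => a * q.1) = a \*: (fun q : R * R => q.1) by [].
rewrite deriveZ; last exact: diff_derivable.
by rewrite derive_fst /GRing.scale/= /exp_wave; ring.
Qed.

Lemma pdx_exp_wave a i : pd i 0 (exp_wave a) = fun p => a ^+ i * exp_wave a p.
Proof.
elim: i => [|i IH]; first by apply/funext => p; rewrite expr0 mul1r.
have -> : pd i.+1 0 (exp_wave a) = pdx (pd i 0 (exp_wave a)) by [].
rewrite IH; apply/funext => p; rewrite /pdx derive_exp_wave /= exprS; ring.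
Qed.

Lemma pdt_exp_wave a i p : pd i 1 (exp_wave a) p = 0.
Proof.
have -> : pd i 1 (exp_wave a) = pdt (pd i 0 (exp_wave a)) by [].
by rewrite pdx_exp_wave /pdt derive_exp_wave /= !mulr0 mul0r.
Qed.

(* A stationary exponential exp (a x) solves the equation iff
   2 a (3 a + 1) (a - 1) = 0; for a = 1 the form omega1 vanishes. *)
Lemma generalized_CH_exp_wave p : generalized_CH (exp_wave (- 3^-1)) p.
Proof.
rewrite /generalized_CH !pdt_exp_wave !pdx_exp_wave.
by field.
Qed.

Lemma wedge_exp_wave eta p :
  wedge (omega1 (gch_coeffs eta) (exp_wave (- 3^-1)))
        (omega2 (gch_coeffs eta) (exp_wave (- 3^-1))) p =
  - (4 / 9) * exp_wave (- 3^-1) p * (eta + 2 * exp_wave (- 3^-1) p ^+ 2).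
Proof.
rewrite /wedge cdx_omega1 cdt_omega1 cdx_omega2 cdt_omega2 /gch_flux.
by rewrite !pdx_exp_wave; field.
Qed.

(** For eta < 0 the last factor of the wedge vanishes on a line x = const. Taking U to be the
    complement of its zero set makes the exceptional set empty, hence negligible. *)
Lemma generic_exp_wave eta : exists U,
  [/\ open U, U !=set0 & generic (gch_coeffs eta) U (exp_wave (- 3^-1))].
Proof.
set w := exp_wave _.
exists [set p | eta + 2 * w p ^+ 2 != 0]; split.
- have ew : elementary (fun p => eta + 2 * w p ^+ 2).
    apply: Elem_add; first exact: Elem_cst.
    apply: Elem_mul; first exact: Elem_cst.
    exact/elementary_exprn/elementary_exp_wave.
  apply: (@open_comp _ _ (fun p => eta + 2 * w p ^+ 2) [set y | y != 0]).
    by move=> p _; exact/differentiable_continuous/elementary_differentiable.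
  exact: open_neq.
(* At the origin the factor is eta + 2. If eta = -2, the point (-3, 0) is used, where the wave
   equals e and the factor is 2 (e^2 - 1) > 0. *)
- have [e2|ne2] := eqVneq eta (- 2); last first.
    exists (0, 0) => /=; rewrite /w /exp_wave /= mulr0 expR0 expr1n mulr1.
    by rewrite addr_eq0.
  exists (- 3, 0) => /=; rewrite /w /exp_wave /= mulrNN mulVf ?pnatr_eq0//.
  have e1 : 1 < expR (1 : R) by rewrite expR_gt1.
  by rewrite e2 gt_eqF//; nra.
- rewrite /generic /null_set (_ : [set _ | _] = set0).
    exact: negligible_set0.
  rewrite -subset0 => p [/= /negP nz]; rewrite wedge_exp_wave => /eqP.
  rewrite mulf_eq0 => /orP[|//].
  rewrite mulf_eq0 => /orP[|]; last by rewrite gt_eqF// expR_gt0.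
  by rewrite oppr_eq0 mulf_eq0 invr_eq0 !pnatr_eq0.
Qed.

Lemma gch_pss_forms eta : pss_forms 3 (@generalized_CH R) (gch_coeffs eta).
Proof.
split=> [U u oU Cu|].
  by split=> S p Up; have [h1 h2] := structure_equations_gch eta Cu Up; auto.
have [U [oU U0 gU]] := generic_exp_wave eta.
exists U, (exp_wave (- 3^-1)); split => //.
  exact/elementary_Ck/elementary_exp_wave.
by move=> p _; exact: generalized_CH_exp_wave.
Qed.

(** * The solution u = 1 and gauge equivalence *)

Lemma pd_cst (c : R) i j : exists c', pd i j (fun=> c) = fun=> c'.
Proof.
have D (v : R * R) (b : R) : (fun p => 'D_v (fun=> b) p) = fun=> 0.
  by apply/funext => p; exact: derive_cst.
have [b Eb] : exists b, iter i pdx (fun=> c) = fun=> b.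
  elim: i => [|i [b IH]]; first by exists c.
  by exists 0; rewrite /= IH; exact: D.
rewrite /pd Eb; elim: j => [|j [b' IH]]; first by exists b.
by exists 0; rewrite /= IH; exact: D.
Qed.

Lemma jet_cst M (c : R) p q : jet M (fun=> c) p = jet M (fun=> c) q.
Proof. by apply/matrixP => i j; rewrite !mxE; have [b ->] := pd_cst c i j. Qed.

Lemma pdx_cst (c : R) i p : pd i.+1 0 (fun=> c) p = 0.
Proof.
have [b Eb] := pd_cst c i 0.
have -> : pd i.+1 0 (fun=> c) = pdx (pd i 0 (fun=> c)) by [].
by rewrite Eb; exact: derive_cst.
Qed.

(** At u = 1 one has m = 1, Q = 0 and u - u_x = 1, so all three forms equal dx + eta dt. *)
Lemma Omega_dx_cst eta p :
  Omega_dx (gch_coeffs eta) (fun=> 1) p = sl2_mx 1 1 1.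
Proof.
rewrite /Omega_dx omega3E cdx_omega1 cdx_omega2 pdx_cst.
by rewrite subr0.
Qed.

Lemma Omega_dt_cst eta p :
  Omega_dt (gch_coeffs eta) (fun=> 1) p = eta *: sl2_mx 1 1 1.
Proof.
rewrite /Omega_dt omega3E cdt_omega1 cdt_omega2 !pdx_cst /gch_flux.
rewrite /sl2_mx; apply/matrixP => i j; rewrite !mxE.
by case: ifP => _; case: ifP => _; ring.
Qed.

(* On the solution u = 1 every jet is constant, so that a gauge transformation
   acts by conjugation, while Omega_dt = eta Omega_dx. *)
Lemma gch_gauge_injective eta eta' :
  gauge_equivalent 3 (@generalized_CH R) (gch_coeffs eta) (gch_coeffs eta') ->
  eta = eta'.
Proof.
move=> [M [S [_ detS gS]]].
pose u : R * R -> R := fun=> 1.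
have Cu : Ck (maxn 3 (maxn 2 M).+1) setT u by exact/elementary_Ck/Elem_cst.
have su : solution (@generalized_CH R) setT u.
  move=> p _; have [b Eb] := pd_cst 1 2 0.
  rewrite /generalized_CH !pdx_cst.
  have -> : pd 0 1 u p = 0 by exact: derive_cst.
  have -> : pd 2 1 u p = 0.
    have -> : pd 2 1 u = pdt (pd 2 0 u) by [].
    by rewrite Eb; exact: derive_cst.
  by ring.
have [] := gS _ _ openT Cu su (0, 0) I.
have -> : (fun q => S (jet M u q)) = cst (S (jet M u (0, 0))).
  by apply/funext => q; rewrite (jet_cst M 1 q (0, 0)).
rewrite !derive_cst !addr0 !Omega_dx_cst !Omega_dt_cst /=.
set S0 := S _; set X := sl2_mx 1 1 1 => XS.
(* The dx part says X S0 = S0 X, so the dt part becomes (eta' - eta) X S0 = 0. *)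
rewrite -scalemxAl -scalemxAr -XS => /eqP; rewrite -subr_eq0 -scalerBl.
rewrite scaler_eq0 subr_eq0 => /orP[/eqP->//|/eqP XS0].
(* X S0 = 0 with S0 invertible would force X = 0, but the top-left entry of X is 1/2. *)
have uS : S0 \in unitmx by rewrite unitmxE detS unitr1.
have /matrixP/(_ 0 0)/eqP : X = 0 by rewrite -(mulmxK uS X) XS0 mul0mx.
by rewrite !mxE /= mulr1 invr_eq0 pnatr_eq0.
Qed.

End Solutions.

Theorem theorem1 (R : realType) :
  describes_pss 3 (@generalized_CH R) /\
  geometrically_integrable 3 (@generalized_CH R).
Proof.
split.
  (* Any member of the family would do; eta = 0 is taken. *)
  exists 2%N, (gch_coeffs 0%R); split; last exact: gch_pss_forms.
  exact: gch_coeffs_smooth.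
exists 2%N, gch_coeffs; split.
- exact: gch_coeffs_family_smooth.
- exact: gch_pss_forms.
- by move=> eta eta' ne /gch_gauge_injective.
Qed.
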